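(* Let $\alpha=(\alpha_1,\dots,\alpha_r)$ be a sequence of nonnegative integers with sum $n$ and $\gcd(\alpha_1,\dots,\alpha_r)=1$, and write $C(\alpha;q)=\sum_i a_iq^i$. Let $X$ be the set of $\alpha$-necklaces, with the involution $\tau_0$ acting on $X$ by reflection. Then $(X, C(\alpha;q), \langle\tau_0\rangle)$ exhibits Stembridge's $q=-1$ phenomenon; that is, $$\tfrac12\big(C(\alpha;1)+C(\alpha;-1)\big)=a_0+a_2+a_4+\cdots$$ equals the total number of bracelets, and $$\tfrac12\big(C(\alpha;1)-C(\alpha;-1)\big)=a_1+a_3+a_5+\cdots$$ equals the number of asymmetric bracelets.
   Context: $[n]_q=1+q+\cdots+q^{n-1}$, $[n]!_q=[n]_q\cdots[1]_q$, and $C(\alpha;q)=\frac{1}{[n]_q}\frac{[n]!_q}{[\alpha_1]!_q\cdots[\alpha_r]!_q}$ (a polynomial with nonnegative integer coefficients when $\gcd(\alpha)=1$). Let $W(\alpha)$ be the set of words of length $n$ with exactly $\alpha_i$ occurrences of the letter $i$ for each $i$; $S_n$ acts on $W(\alpha)$ by permuting positions. With $c=(1,2,\dots,n)$ and $C=\langle c\rangle$, the $C$-orbits on $W(\alpha)$ are called $\alpha$-necklaces. Let $\tau_0\in S_n$ be the permutation fixing $n$ and sending $i\mapsto n-i$ for $1\le i\le n-1$; it normalizes $C$ and hence acts on necklaces (by $\tau_0\cdot Cw=C(\tau_0\cdot w)$); this is reflection of necklaces. Orbits of this $\langle\tau_0\rangle$-action on necklaces are called bracelets, and a bracelet is asymmetric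 if it is an orbit of size two. A triple $(X,X(q),\tau)$ with $\tau$ an involution exhibits Stembridge's $q=-1$ phenomenon if $X(1)=|X|$ and $X(-1)=|\{x\in X:\tau(x)=x\}|$. *)

(* Defs.v *)
From mathcomp Require Import all_boot all_order all_fingroup all_algebra.
From mathcomp Require Import zify.

Set Implicit Arguments.
Unset Strict Implicit.
Unset Printing Implicit Defensive.

Import GRing.Theory.

Local Open Scope ring_scope.

Definition qint (n : nat) : {poly int} := \sum_(i < n) 'X^i.

Definition qfact (n : nat) : {poly int} := \prod_(i < n) qint i.+1.

Definition qmultinomial (n r : nat) (alpha : 'I_r -> nat) : {poly int} :=
  qfact n %/ \prod_(i < r) qfact (alpha i).

(* C(alpha; q) for alpha of sum n.  All divisors are monic, so %/ on
   {poly int} is Euclidean division with quotient in Z[q]; both divisions are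
   exact when alpha has sum n and gcd 1. *)
Definition qC (n r : nat) (alpha : 'I_r -> nat) : {poly int} :=
  qmultinomial n alpha %/ qint n.

Local Open Scope group_scope.

(* Positions 1, ..., n are represented by the ordinals 0, ..., n - 1. *)
Definition word (n r : nat) := {ffun 'I_n -> 'I_r}.

Definition words (n r : nat) (alpha : 'I_r -> nat) : {set word n r} :=
  [set w : word n r | [forall i, #|[set j | w j == i]| == alpha i]].

(* The letter of w at position j moves to position s j.  Since permutations
   compose left to right in {perm _}, this is an action in the sense of
   action.v. *)
Definition permw (n r : nat) (w : word n r) (s : {perm 'I_n}) : word n r :=
  [ffun j => w (s^-1 j)].

Lemma permw1 n r (w : word n r) : permw w 1 = w.
Proof. by apply/ffunP=> j; rewrite ffunE invg1 perm1. Qed.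

Lemma permwM n r (w : word n r) : act_morph (@permw n r) w.
Proof. by move=> s t; apply/ffunP=> j; rewrite !ffunE invMg permM. Qed.

Definition wact (n r : nat) : {action {perm 'I_n} &-> word n r} :=
  TotalAction (@permw1 n r) (@permwM n r).

Lemma words_act n r (alpha : 'I_r -> nat) (w : word n r) (s : {perm 'I_n}) :
  (wact n r w s \in words n alpha) = (w \in words n alpha).
Proof.
rewrite !inE; apply: eq_forallb => i; congr (_ == _).
rewrite -(card_preimset [set j | w j == i] (@perm_inj _ s^-1)).
by apply: eq_card => j; rewrite !inE ffunE.
Qed.

(* c = (1, 2, ..., n) *)
Definition rot_perm (n : nat) : {perm 'I_n} := perm (@ordS_inj n).

(* tau_0, which fixes n and sends i to n - i for 1 <= i <= n - 1; see
   val_refl_perm for the explicit formula on ordinals. *)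
Definition refl_perm (n : nat) : {perm 'I_n} :=
  perm (inj_comp (@ord_pred_inj n) (@rev_ord_inj n)).

Lemma val_refl_perm n (j : 'I_n) :
  refl_perm n j = (if j.+1 == n then n.-1 else n - j.+2)%N :> nat.
Proof.
rewrite permE /=; have := ltn_ord j; case: eqP => [jn _ | jn ltjn].
  by rewrite -{1}jn subnn add0n modn_small // prednK // -jn.
have -> : ((n - j.+1 + n).-1 = n - j.+2 + n)%N by lia.
by rewrite modnDr modn_small //; lia.
Qed.

Definition necklaces (n r : nat) (alpha : 'I_r -> nat) : {set {set word n r}} :=
  orbit (wact n r) <[rot_perm n]> @: words n alpha.

(* tau_0 acts on necklaces as on arbitrary sets of words, elementwise;
   refl_necklace_orbit gives tau_0 . C w = C (tau_0 . w). *)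
Definition refl_necklace (n r : nat) (N : {set word n r}) : {set word n r} :=
  ((wact n r)^* N (refl_perm n))%act.

Lemma refl_perm_norm n : refl_perm n \in 'N(<[rot_perm n]>).
Proof.
suff cJ : rot_perm n ^ refl_perm n = (rot_perm n)^-1.
  by rewrite inE -cycleJ cJ cycleV.
apply: (mulIg (rot_perm n)); rewrite mulVg conjgE.
apply: (mulgI (refl_perm n)); rewrite !mulgA mulgV mul1g mulg1.
apply/permP=> j; rewrite !permM !permE /= ord_predK.
apply: val_inj => /=; have ltjn := ltn_ord j.
have [jn | ltSjn] := eqVneq j.+1 n.
  have -> : ((n - j.+1 + n).-1 = n.-1)%N by lia.
  by rewrite jn modnn modn_small; lia.
have -> : ((n - j.+1 + n).-1 = n - j.+2 + n)%N by lia.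
by rewrite modnDr !modn_small; lia.
Qed.

Lemma refl_necklace_orbit n r (w : word n r) :
  refl_necklace (orbit (wact n r) <[rot_perm n]> w) =
    orbit (wact n r) <[rot_perm n]> (wact n r w (refl_perm n)).
Proof.
by rewrite /refl_necklace /= setact_orbit (normP (refl_perm_norm n)).
Qed.

Definition bracelets (n r : nat) (alpha : 'I_r -> nat) :
    {set {set {set word n r}}} :=
  orbit ((wact n r)^*)%act <[refl_perm n]> @: necklaces n alpha.

Definition asymmetric_bracelets (n r : nat) (alpha : 'I_r -> nat) :
    {set {set {set word n r}}} :=
  [set B in bracelets n alpha | #|B| == 2].

Local Open Scope ring_scope.

(* The first two conjuncts say that tau is an involution of X. *)
Definition stembridge_phenomenon (T : finType) (X : {set T}) (P : {poly int})
    (tau : T -> T) : Prop :=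
  [/\ {in X, forall x, tau x \in X},
      {in X, involutive tau},
      P.[1] = #|X|%:Z
    & P.[-1] = #|[set x in X | tau x == x]|%:Z].

(* Main.v *)
Require Import Defs.
From mathcomp Require Import all_boot all_order all_fingroup all_algebra.
From mathcomp Require Import zify ring.

(* Write beta_i for the floor of alpha_i / 2 and m for the floor of (n - 1) / 2.
   Since [k]!_q is [2]_q^(floor (k / 2)) times a polynomial with value
   (floor (k / 2))! at q = -1, C(alpha; -1) is the multinomial coefficient
   (m; beta) if the beta_i add up to m, and 0 otherwise.

   As gcd(alpha) = 1, C acts freely on words, so that C(alpha; 1) counts the
   necklaces.  The reflection acts on a fixed necklace as x |-> a - x acts on
   Z/n, so a fixed necklace contains one fixed word if n is odd, and zero or two
   if n is even, where zero is excluded by gcd(alpha) = 1.  A word fixed by tau_0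
   consists of its first m letters, which form a word of content beta, and of
   the letters at the positions fixed by tau_0 (one if n is odd, two if n is
   even); these are the letters i with alpha_i odd, in any order.  Hence
   C(alpha; -1) counts the fixed necklaces. *)

Set Implicit Arguments.
Unset Strict Implicit.
Unset Printing Implicit Defensive.

Import GRing.Theory.

Local Open Scope ring_scope.

(** * Divisibility of q-factorials and integrality of [qC] *)

Lemma qint0 : qint 0 = 0.
Proof. by rewrite /qint big_ord0. Qed.

Lemma qint1 : qint 1 = 1.
Proof. by rewrite /qint big_ord1. Qed.

Lemma qintD a b : qint (a + b) = qint a + 'X^a * qint b.
Proof.
rewrite /qint big_split_ord /= mulr_sumr; congr (_ + _).
by apply: eq_bigr => i _; rewrite exprD.
Qed.

Lemma qint_monic n : qint n.+1 \is monic.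
Proof.
suff -> : qint n.+1 = \poly_(i < n.+1) 1 by rewrite monicE lead_coef_poly.
by rewrite poly_def; apply: eq_bigr => i _; rewrite scale1r.
Qed.

Lemma qfactS n : qfact n.+1 = qfact n * qint n.+1.
Proof. by rewrite /qfact big_ord_recr. Qed.

Lemma qfact_monic n : qfact n \is monic.
Proof. by apply: monic_prod => i _; apply: qint_monic. Qed.

(** [G] is the Gaussian binomial coefficient, built by its Pascal recurrence: splitting the top
    factor as [a+1] + q^(a+1) [b+1] leaves two smaller instances. *)
Lemma qfactD a b : exists G, qfact (a + b) = G * (qfact a * qfact b).
Proof.
have [s] := ubnP (a + b)%N; elim: s a b => // s IH [|a] [|b] lt_s.
- by exists 1; rewrite /qfact big_ord0 !mulr1.
- by exists 1; rewrite /qfact [\prod_(i < 0) _]big_ord0 !mul1r add0n.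
- by exists 1; rewrite /qfact [\prod_(i < 0) _]big_ord0 !mulr1 mul1r addn0.
have [|G1 E1] := IH a b.+1; first lia.
have [|G2 E2] := IH a.+1 b; first lia.
exists (G1 + 'X^(a.+1) * G2).
have -> : (a.+1 + b.+1 = (a + b.+1).+1)%N by lia.
rewrite qfactS; have -> : (a + b.+1).+1 = (a.+1 + b.+1)%N by lia.
rewrite qintD mulrDr {1}E1 (_ : (a + b.+1 = a.+1 + b)%N) ?E2; last lia.
by rewrite !qfactS; ring.
Qed.

Lemma qfact_sum r (alpha : 'I_r -> nat) :
  exists M, qfact (\sum_(i < r) alpha i) = M * \prod_(i < r) qfact (alpha i).
Proof.
elim/big_rec2: _ => [|i x y _ [M EM]].
  by exists 1; rewrite mulr1 /qfact big_ord0.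
have [G EG] := qfactD (alpha i) y; exists (G * M).
by rewrite EG EM; ring.
Qed.

(* [a]_q = [a + b]_q - q^a [b]_q, so that the subtractive Euclidean algorithm
   can be run inside Z[q]. *)
Lemma qint_gcd (M D : {poly int}) a b :
    (exists Q, qint a * M = Q * D) -> (exists Q, qint b * M = Q * D) ->
  exists Q, qint (gcdn a b) * M = Q * D.
Proof.
have [s] := ubnP (a + b)%N.
elim: s a b => // s IH a b lt_s; wlog le_ab: a b lt_s / (a <= b)%N.
  move=> W; case: (leqP a b) => [/W|/ltnW /W]; first exact.
  by rewrite gcdnC addnC => /(_ lt_s) W' Pa Pb; apply: W'.
case: a lt_s le_ab => [|a] lt_s le_ab; first by rewrite gcd0n.
have Eb : b = (b - a.+1 + a.+1)%N by lia.
move=> Pa Pb; have Pc : exists Q, qint (b - a.+1) * M = Q * D.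
  case: Pa Pb => [Qa Ea] [Qb]; rewrite {1}Eb qintD mulrDl -mulrA Ea => EQ.
  exists (Qb - 'X^(b - a.+1) * Qa); rewrite mulrBl -EQ; ring.
rewrite Eb gcdnDr; apply: IH => //; lia.
Qed.

(** Replaces both Euclidean divisions by one identity in Z[q], the form in which [qC] is evaluated
    later. The point is that [n]_q divides the q-multinomial [M]: it divides every [alpha_i]_q [M],
    hence also [1]_q [M] by [qint_gcd]. *)
Lemma qC_eq p r (alpha : 'I_r -> nat) :
    (\sum_(i < r) alpha i = p.+1)%N ->
    \big[gcdn/0%N]_(i < r) alpha i = 1%N ->
  qC p.+1 alpha * \prod_(i < r) qfact (alpha i) = qfact p.
Proof.
move=> sum_a gcd_a; have [M EM] := qfact_sum alpha; rewrite sum_a in EM.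
have mon : \prod_(i < r) qfact (alpha i) \is monic.
  by apply: monic_prod => i _; apply: qfact_monic.
rewrite /qC /qmultinomial EM Pdiv.IdomainMonic.mulpK //.
have [Q] : exists Q, qint 1 * M = Q * qint p.+1.
  rewrite -gcd_a; elim/big_ind: _ => [||i _].
  - by exists 0; rewrite qint0 !mul0r.
  - by move=> x y; apply: qint_gcd.
  case Eai: (alpha i) => [|a]; first by exists 0; rewrite qint0 !mul0r.
  (* [M'] is the q-multinomial of the content with [alpha i] lowered by one; it satisfies
     [alpha_i]_q [M] = [n]_q [M']. *)
  have [M' EM'] := qfact_sum (fun j => (alpha j - (j == i))%N).
  have sum_a' : (\sum_(j < r) (alpha j - (j == i)) = p)%N.
    move: sum_a; rewrite !(bigD1 (P := xpredT) i) //= eqxx Eai.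
    rewrite subn1 /= addSn => -[<-]; congr addn.
    by apply: eq_bigr => j /negPf ->; rewrite subn0.
  exists M'; apply: (mulIf (monic_neq0 mon)).
  rewrite -mulrA -EM qfactS -{1}sum_a' EM'.
  rewrite !(bigD1 (P := xpredT) i) //= eqxx Eai subn1 /= qfactS.
  rewrite (eq_bigr (fun j => qfact (alpha j))); first by ring.
  by move=> j /negPf ->; rewrite subn0.
rewrite qint1 mul1r => EQ; rewrite EQ Pdiv.IdomainMonic.mulpK ?qint_monic //.
apply: (mulIf (monic_neq0 (qint_monic p))).
by rewrite -qfactS EM EQ; ring.
Qed.

(** * Values at q = 1 and q = -1 *)

Lemma horner_qint1 n : (qint n).[1] = n%:R.
Proof.
rewrite /qint horner_sum (eq_bigr (fun=> 1)); last first.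
  by move=> i _; rewrite hornerXn expr1n.
by rewrite sumr_const card_ord.
Qed.

Lemma horner_qfact1 n : (qfact n).[1] = n`!%:R.
Proof.
elim: n => [|n IH]; first by rewrite /qfact big_ord0 hornerC.
by rewrite qfactS hornerM IH horner_qint1 factS mulnC natrM.
Qed.

(** The second factor is [k] taken at q^2, so its value at q = -1 is k and the zero there comes from
    [2]_q alone. *)
Lemma qint_double k : qint k.*2 = qint 2 * \sum_(i < k) 'X^(i.*2).
Proof.
elim: k => [|k IH]; first by rewrite big_ord0 mulr0 qint0.
rewrite doubleS -addn2 qintD IH big_ord_recr /= mulrDr; ring.
Qed.

Lemma horner_qint2N1 : (qint 2).[-1] = 0.
Proof. by rewrite /qint !big_ord_recl big_ord0 !hornerE. Qed.

Lemma horner_qintN1_odd k : (qint k.*2.+1).[-1] = 1.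
Proof.
rewrite -addn1 qintD qint_double qint1 mulr1 hornerD hornerM horner_qint2N1.
by rewrite mul0r add0r hornerXn -mul2n exprM sqrrN !expr1n.
Qed.

(* [k]_q vanishes simply at q = -1 for even k, and is 1 there for odd k. *)
Lemma qfact_factor2 n :
  exists2 g, qfact n = qint 2 ^+ n./2 * g & g.[-1] = (n./2)`!%:R.
Proof.
elim: n => [|n [g Eg gN1]].
  by exists 1; rewrite ?hornerC // /qfact big_ord0 mulr1.
rewrite qfactS Eg; have En := odd_double_half n; case: (boolP (odd n)) => odd_n.
  have -> : n.+1./2 = n./2.+1 by lia.
  exists (g * \sum_(i < n./2.+1) 'X^(i.*2)).
    by rewrite (_ : n.+1 = n./2.+1.*2) ?qint_double ?exprS; [ring|lia].
  rewrite hornerM gN1 horner_sum (eq_bigr (fun=> 1)) => [|i _]; last first.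
    by rewrite hornerXn -mul2n exprM sqrrN !expr1n.
  by rewrite sumr_const card_ord factS mulnC natrM.
have -> : n.+1./2 = n./2 by lia.
exists (g * qint n.+1); first by rewrite mulrA.
by rewrite hornerM gN1 (_ : n.+1 = n./2.*2.+1) ?horner_qintN1_odd ?mulr1; lia.
Qed.

Lemma common_divisor_eq1 r (alpha : 'I_r -> nat) d :
    \big[gcdn/0%N]_(i < r) alpha i = 1%N ->
  (forall i, (d %| alpha i)%N) -> d = 1%N.
Proof.
move=> gcd_a d_dvd; apply/eqP; rewrite -dvdn1 -[X in (_ %| X)%N]gcd_a.
by elim/big_ind: _ => // x y dx dy; rewrite dvdn_gcd dx.
Qed.

Lemma sum_half r (alpha : 'I_r -> nat) :
  (\sum_(i < r) alpha i =
     (\sum_(i < r) (alpha i)./2).*2 + #|[set i | odd (alpha i)]|)%N.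
Proof.
have -> : (#|[set i | odd (alpha i)]| = \sum_(i < r) odd (alpha i))%N.
  by rewrite cardsE -sum1_card [LHS]big_mkcond; apply: eq_bigr => i _.
rewrite -mul2n big_distrr -big_split /=.
by apply: eq_bigr => i _; rewrite mul2n addnC odd_double_half.
Qed.

(** Some [alpha i] is odd because the gcd is 1, so [sum_half] bounds twice the sum of the halves by
    [p]. *)
Lemma sum_half_le p r (alpha : 'I_r -> nat) :
    (\sum_(i < r) alpha i = p.+1)%N ->
    \big[gcdn/0%N]_(i < r) alpha i = 1%N ->
  (\sum_(i < r) (alpha i)./2 <= p./2)%N.
Proof.
move=> sum_a gcd_a; have := sum_half alpha; rewrite sum_a.
case: (set_0Vmem [set i | odd (alpha i)]) => [O0|[i Oi]]; last first.
  by rewrite (cardsD1 i) Oi; lia.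
suff: 2%N = 1%N by [].
apply: (common_divisor_eq1 gcd_a) => i.
by have := in_set0 i; rewrite -O0 inE dvdn2 => ->.
Qed.

Lemma qC_horner1 p r (alpha : 'I_r -> nat) :
    (\sum_(i < r) alpha i = p.+1)%N ->
    \big[gcdn/0%N]_(i < r) alpha i = 1%N ->
  (qC p.+1 alpha).[1] * (\prod_(i < r) (alpha i)`!)%N%:R = p`!%:R.
Proof.
move=> sum_a gcd_a; rewrite -horner_qfact1 -(qC_eq sum_a gcd_a) hornerM.
rewrite natr_prod horner_prod; congr (_ * _).
by apply: eq_bigr => i _; rewrite horner_qfact1.
Qed.

Lemma qC_hornerN1 p r (alpha : 'I_r -> nat) :
    (\sum_(i < r) alpha i = p.+1)%N ->
    \big[gcdn/0%N]_(i < r) alpha i = 1%N ->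
  (qC p.+1 alpha).[-1] * (\prod_(i < r) (alpha i)./2`!)%N%:R =
    (((\sum_(i < r) (alpha i)./2 == p./2) * p./2`!)%N)%:R.
Proof.
move=> sum_a gcd_a; have le_p := sum_half_le sum_a gcd_a.
have [h Eh hN1] : exists2 h, \prod_(i < r) qfact (alpha i) =
    qint 2 ^+ (\sum_(i < r) (alpha i)./2) * h
  & h.[-1] = (\prod_(i < r) (alpha i)./2`!)%N%:R.
  elim/big_rec3: _ => [|i x y z _ [h -> hN1]].
    by exists 1; rewrite ?hornerC // mulr1.
  have [g -> gN1] := qfact_factor2 (alpha i).
  exists (g * h); first by rewrite exprD; ring.
  by rewrite hornerM gN1 hN1 natrM.
have [g Eg gN1] := qfact_factor2 p.
(* The common power of [2]_q is cancelled before evaluating, since [2]_q vanishes at -1. The power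
   left on the right is 0 there unless its exponent is 0. *)
have := qC_eq sum_a gcd_a; rewrite Eh Eg -(subnK le_p) exprD => /eqP.
rewrite subnK // mulrCA -[X in _ == X]mulrA [X in _ == X]mulrCA.
rewrite (inj_eq (mulfI (monic_neq0 _))); last exact/monic_exp/qint_monic.
move/eqP/(congr1 (fun P => P.[-1])); rewrite !hornerM hN1 gN1 => ->.
by rewrite natrM horner_exp horner_qint2N1 expr0n subn_eq0 eqn_leq le_p.
Qed.

(** * Counting words of given content *)

Lemma wordsP n r (alpha : 'I_r -> nat) (w : word n r) :
  reflect (forall i, (\sum_(j < n) (w j == i) = alpha i)%N)
          (w \in words n alpha).
Proof.
have E i : (#|[set j | w j == i]| = \sum_(j < n) (w j == i))%N.
  by rewrite cardsE -sum1_card [LHS]big_mkcond; apply: eq_bigr => j _.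
rewrite inE; apply: (iffP forallP) => H i; have := H i; rewrite E.
  by move/eqP.
by move=> ->.
Qed.

Lemma sum_words n r (alpha : 'I_r -> nat) (w : word n r) :
  w \in words n alpha -> (\sum_(i < r) alpha i = n)%N.
Proof.
move/wordsP=> Hw; rewrite -(eq_bigr _ (fun i _ => Hw i)) exchange_big /=.
rewrite (eq_bigr (fun=> 1%N)); first by rewrite sum1_card card_ord.
move=> j _; rewrite (bigD1 (w j)) //= eqxx big1 // => i.
by rewrite eq_sym => /negPf ->.
Qed.

Definition wcons n r (u : 'I_r * word n r) : word n.+1 r :=
  [ffun j => if unlift ord0 j is Some k then u.2 k else u.1].

Lemma wcons_bij n r : bijective (@wcons n r).
Proof.
exists (fun w : word n.+1 r =>
  (w ord0, [ffun k : 'I_n => w (lift ord0 k)] : word n r)).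
  case=> i v; rewrite /wcons ffunE unlift_none /=; congr pair.
  by apply/ffunP=> k; rewrite !ffunE liftK.
move=> w; apply/ffunP=> j; rewrite ffunE; case: unliftP => [k|] -> //=.
by rewrite ffunE.
Qed.

(** The guard [0 < alpha i] matters because subtraction truncates: for [alpha i = 0] the lowered
    content would again be [alpha]. *)
Lemma wcons_words n r (alpha : 'I_r -> nat) i (v : word n r) :
  (wcons (i, v) \in words n.+1 alpha) =
    (0 < alpha i)%N && (v \in words n (fun a => alpha a - (i == a))%N).
Proof.
have E a : (\sum_(j < n.+1) (wcons (i, v) j == a) =
    (i == a) + \sum_(j < n) (v j == a))%N.
  rewrite big_ord_recl ffunE unlift_none /=; congr addn.
  by apply: eq_bigr => j _; rewrite ffunE liftK.
apply/wordsP/andP => [H|[ai_gt0 /wordsP H] a].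
  split; first by rewrite -H E eqxx.
  by apply/wordsP=> a; rewrite -H E addKn.
rewrite E H; case: eqP => [<-|_]; last by rewrite subn0.
by rewrite subnKC.
Qed.

(** Induction on the length, sorting words by first letter: those beginning with [i] account for
    [alpha i] times the factorial of the remaining length, and the [alpha i] add up to the full
    length. *)
Lemma card_words n r (alpha : 'I_r -> nat) :
    (\sum_(i < r) alpha i = n)%N ->
  (#|words n alpha| * \prod_(i < r) (alpha i)`! = n`!)%N.
Proof.
elim: n alpha => [|n IH] alpha sum_a.
  have a0 i : alpha i = 0%N.
    by apply/eqP; rewrite -leqn0 -sum_a (bigD1 i) //= leq_addr.
  rewrite big1 => [|i _]; last by rewrite a0.
  rewrite muln1 (eq_card (B := predT)) ?card_ffun ?card_ord ?expn0 // => w.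
  by rewrite [RHS]inE; apply/wordsP=> i; rewrite big_ord0 a0.
rewrite -sum1_card (reindex _ (onW_bij _ (@wcons_bij n r))) /=.
rewrite (eq_bigl (fun u : 'I_r * word n r => (0 < alpha u.1) &&
   (u.2 \in words n (fun a => alpha a - (u.1 == a)))))%N; last first.
  by case=> i v; rewrite wcons_words.
rewrite -(pair_big_dep (fun i => (0 < alpha i)%N)
  (fun i v => v \in words n (fun a => (alpha a - (i == a))%N)) (fun _ _ =>
    1%N)) /=.
rewrite big_distrl /= factS -sum_a big_distrl /= [RHS](bigID (fun i => 0 <
  alpha i)%N) /=.
rewrite [X in (_ + X)%N]big1 ?addn0 => [|i]; last first.
  by rewrite lt0n negbK => /eqP ->.
apply: eq_bigr => i ai_gt0; rewrite sum1_card -(IH (fun a => alpha a - (i ==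
  a))%N).
  rewrite mulnCA; congr muln; rewrite !(bigD1 (P := xpredT) i) //= eqxx subn1.
  rewrite -{1}(prednK ai_gt0) factS prednK // mulnA; congr muln.
  by apply: eq_bigr => j; rewrite eq_sym => /negPf ->; rewrite subn0.
move: sum_a; rewrite !(bigD1 (P := xpredT) i) //= eqxx subn1.
rewrite [in X in _ -> X](eq_bigr alpha); first by lia.
by move=> j; rewrite eq_sym => /negPf ->; rewrite subn0.
Qed.

(** * Rotation and reflection as maps on Z/n, n = [p.+1] *)

Definition wshift p r (w : word p.+1 r) (k : 'I_p.+1) : word p.+1 r :=
  [ffun j => w (j - k)].

(* The ordinal j stands for the position j + 1, and tau_0 negates positions
   modulo n, hence j |-> - (j + 1) - 1. *)
Definition wrefl p r (w : word p.+1 r) : word p.+1 r :=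
  [ffun j => w (- j - inZp 2)].

Lemma rot_permX p m (j : 'I_p.+1) : (rot_perm p.+1 ^+ m)%g j = j + inZp m.
Proof.
rewrite permX; elim: m => [|m IH]; first by apply: val_inj;
  rewrite /= modnDmr addn0 modn_small.
rewrite iterS IH permE; apply: val_inj => /=.
by rewrite -[X in (X %% _)%N]addn1 modnDml addnAC !modnDmr addn1 addSnnS.
Qed.

Lemma wact_rot p r (w : word p.+1 r) m :
  wact p.+1 r w (rot_perm p.+1 ^+ m)%g = wshift w (inZp m).
Proof.
apply/ffunP=> j; rewrite !ffunE; congr (w _).
by apply: (@perm_inj _ (rot_perm p.+1 ^+ m)%g); rewrite permKV rot_permX subrK.
Qed.

Lemma orbit_rotP p r (w v : word p.+1 r) :
  reflect (exists k, v = wshift w k)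
          (v \in orbit (wact p.+1 r) <[rot_perm p.+1]>%g w).
Proof.
apply: (iffP orbitP) => [[_ /cycleP [m ->] <-]|[k ->]].
  by exists (inZp m); rewrite wact_rot.
exists (rot_perm p.+1 ^+ k)%g; first exact: mem_cycle.
by rewrite wact_rot valZpK.
Qed.

Lemma refl_permE p (j : 'I_p.+1) : refl_perm p.+1 j = - j - inZp 2.
Proof.
suff E : refl_perm p.+1 j + (j + inZp 2) = 0.
  by apply/eqP; rewrite -opprD -addr_eq0 E.
apply: val_inj; rewrite /= modnDmr addnA modnDmr -addnA val_refl_perm /=.
have := ltn_ord j; case: eqP => [[->] _|ne lt_j].
  by rewrite addnA (_ : (p + p + 2 = 2 * p.+1)%N) ?modnMl //; lia.
by rewrite (_ : (p.+1 - j.+2 + (j + 2) = p.+1)%N) ?modnn //; lia.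
Qed.

Lemma wact_refl p r (w : word p.+1 r) :
  wact p.+1 r w (refl_perm p.+1) = wrefl w.
Proof.
apply/ffunP=> j; rewrite !ffunE; congr (w _).
apply: (@perm_inj _ (refl_perm p.+1)); rewrite permKV refl_permE.
by rewrite opprD !opprK addrK.
Qed.

Lemma wshiftD p r (w : word p.+1 r) k l :
  wshift (wshift w k) l = wshift w (k + l).
Proof. by apply/ffunP=> j; rewrite !ffunE opprD addrA addrAC. Qed.

Lemma wshift0 p r (w : word p.+1 r) : wshift w 0 = w.
Proof. by apply/ffunP=> j; rewrite ffunE subr0. Qed.

Lemma wrefl_shift p r (w : word p.+1 r) k :
  wrefl (wshift w k) = wshift (wrefl w) (- k).
Proof.
by apply/ffunP=> j; rewrite !ffunE opprK opprD addrAC.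
Qed.

Lemma wshift_words p r alpha (w : word p.+1 r) k :
  (wshift w k \in words p.+1 alpha) = (w \in words p.+1 alpha).
Proof.
by rewrite -(words_act alpha w (rot_perm p.+1 ^+ k)%g) wact_rot valZpK.
Qed.

(** * Free rotation and necklaces fixed by reflection *)

Section Necklaces.

Variables (p r : nat) (alpha : 'I_r -> nat).
Hypothesis gcd_alpha : \big[gcdn/0%N]_(i < r) alpha i = 1%N.

Implicit Types w v : word p.+1 r.

(* The positions of each letter are a union of cosets of the subgroup
   generated by a period, whose order therefore divides every alpha i. *)
Lemma wshift_free w k :
  w \in words p.+1 alpha -> wshift w k = w -> k = 0.
Proof.
move=> Hw per; suff: #[k]%g = 1%N by move/eqP; rewrite order_eq1 => /eqP.
apply: (common_divisor_eq1 gcd_alpha) => i; move: Hw;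
  rewrite inE => /forallP/(_ i)/eqP <-.
set S := [set _ | _].
have Sk x : w (x + k) = w x by rewrite -[in LHS]per ffunE addrK.
have acts : [acts <[k]>%g, on S | 'R%act].
  apply/actsP=> _ /cycleP[m ->] x; rewrite !inE /= FinRing.zmodMgE
    FinRing.zmodXgE.
  by elim: m => [|m IH]; rewrite ?mulr0n ?addr0 // mulrSr addrA Sk.
rewrite (card_uniform_partition (n := #[k]%g) _ (orbit_partition acts))
  ?dvdn_mull //.
by move=> _ /imsetP[x _ ->]; rewrite orbitR card_lcoset.
Qed.

Lemma wshift_inj w : w \in words p.+1 alpha -> injective (wshift w).
Proof.
move=> Hw k l /(congr1 (fun v => wshift v (- l))).
rewrite !wshiftD subrr wshift0 => /(wshift_free Hw)/eqP.
by rewrite subr_eq0 => /eqP.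
Qed.

(** By freeness every rotation orbit in [words] has exactly n elements. *)
Lemma card_necklaces :
  (#|words p.+1 alpha| = #|necklaces p.+1 alpha| * p.+1)%N.
Proof.
have acts : [acts <[rot_perm p.+1]>%g, on words p.+1 alpha | wact p.+1 r].
  by apply/actsP=> a _ w; apply: words_act.
apply: (card_uniform_partition _ (orbit_partition acts)).
move=> _ /imsetP[w Hw ->].
transitivity #|[set wshift w k | k in 'I_p.+1]|; last first.
  by rewrite card_imset ?card_ord //; apply: wshift_inj.
apply: eq_card => v; apply/orbit_rotP/imsetP => [[k ->]|[k _ ->]]; by exists k.
Qed.

(** For odd [p] the modulus [p.+1] is even, so parity survives reduction. *)
Lemma odd_ord_add (j k : 'I_p.+1) : odd p -> odd (j + k)%R = odd j (+) odd k.
Proof. by move=> odd_p; rewrite /= odd_mod ?oddD //= odd_p. Qed.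

Lemma odd_ord_opp (j : 'I_p.+1) : odd p -> odd (- j)%R = odd j.
Proof.
by move=> odd_p; rewrite /= odd_mod ?oddB //= ?odd_p //; apply: ltnW.
Qed.

(* If n is even and k is odd, then w is invariant under a reflection without
   fixed positions; this reflection exchanges the even and the odd positions,
   so every letter would occur an even number of times. *)
Lemma wrefl_shift_even w k :
    w \in words p.+1 alpha -> wrefl w = wshift w k -> odd p -> ~~ odd k.
Proof.
move=> /wordsP Hw /ffunP sym odd_p; apply/negP=> odd_k.
suff: 2%N = 1%N by [].
apply: (common_divisor_eq1 gcd_alpha) => i;
  rewrite -Hw (bigID (fun j : 'I_p.+1 => odd j)) /=.
pose t (j : 'I_p.+1) := - (j + (inZp 2 + k)).
have tK : involutive t.
  by move=> j; rewrite /t opprD opprK addrK.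
have wt j : w (t j) = w j.
  by have := sym (- j - inZp 2); rewrite !ffunE opprD !opprK addrK /t !opprD
    !addrA => <-.
have odd_t j : odd (t j) = ~~ odd j.
  rewrite odd_ord_opp ?odd_ord_add // odd_k.
  rewrite (_ : odd (inZp 2 : 'I_p.+1) = false);
    last by rewrite /= odd_mod //= odd_p.
  by rewrite /= addbT.
rewrite (reindex_inj (can_inj tK)) /= (eq_bigr (fun j => (w j == i) : nat)).
  by rewrite (eq_bigl _ _ odd_t) addnn dvdn2 odd_double.
by move=> j _; rewrite wt.
Qed.

Definition sym_words := [set w in words p.+1 alpha | wrefl w == w].

Definition sym_necklaces :=
  [set N in necklaces p.+1 alpha | refl_necklace N == N].

(** If reflecting [w] shifts it by k, then shifting [w] by l and reflecting gives the shift by k -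
    l; so any l with l + l = k yields a fixed word. *)
Lemma orbit_sym w :
  w \in words p.+1 alpha ->
  refl_necklace (orbit (wact p.+1 r) <[rot_perm p.+1]>%g w) =
    orbit (wact p.+1 r) <[rot_perm p.+1]>%g w ->
  exists2 l, wshift w l \in sym_words &
    orbit (wact p.+1 r) <[rot_perm p.+1]>%g w =
    orbit (wact p.+1 r) <[rot_perm p.+1]>%g (wshift w l).
Proof.
rewrite refl_necklace_orbit wact_refl => Hw E.
have /orbit_rotP [k Ek] : wrefl w \in orbit (wact p.+1 r) <[rot_perm p.+1]>%g w.
  by rewrite -E orbit_refl.
have [l El] : exists l : 'I_p.+1, l + l = k.
  case: (boolP (odd p)) => odd_p.
    have := wrefl_shift_even Hw Ek odd_p => even_k.
    exists (inZp k./2); apply: val_inj; rewrite /= modnDm addnn.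
    by rewrite even_halfK ?modn_small.
  (* Here n is odd and [p./2.+1] = (n + 1) / 2 is the inverse of 2 modulo n. *)
  exists (inZp (k * p./2.+1)); apply: val_inj; rewrite /= modnDm addnn.
  by rewrite doubleMr doubleS even_halfK // mulnSr modnMDl modn_small.
exists l.
  by rewrite inE wshift_words Hw wrefl_shift Ek wshiftD -El addrK eqxx.
by apply/esym/orbit_eqP/orbit_rotP; exists l.
Qed.

(** The shifts that preserve being fixed by the reflection are those with k = - k: only 0 for odd n,
    and also n / 2 for even n. *)
Lemma card_order2 :
  #|[set k : 'I_p.+1 | k + k == 0]| = (odd p).+1.
Proof.
have E (k : 'I_p.+1) : (k + k == 0) = (k == 0 :> nat) || (k.*2 == p.+1).
  rewrite -val_eqE /= addnn; have lt_k := ltn_ord k.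
  case: (ltnP k.*2 p.+1) => le_k; first by rewrite modn_small //; lia.
  by rewrite -(subnK le_k) modnDr modn_small; lia.
case: (boolP (odd p)) => odd_p; last first.
  rewrite (_ : [set _ | _] = [set 0]) ?cards1 //; apply/setP=> k.
  by rewrite !inE E -val_eqE /=; lia.
rewrite (_ : [set _ | _] = [set 0; inZp p.+1./2]).
  rewrite cards2 -val_eqE /= modn_small; last lia.
  by case: eqP => //; lia.
apply/setP=> k; rewrite !inE E -!val_eqE /= modn_small; last lia.
by congr orb; lia.
Qed.

(** Each fixed necklace contains a fixed word [w] by [orbit_sym]; its other fixed words are the
    shifts of [w] by the k with k + k = 0, and distinct k give distinct words. *)
Lemma card_sym_words : (#|sym_words| = #|sym_necklaces| * (odd p).+1)%N.
Proof.
rewrite -sum1_card (partition_big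
  (fun w => orbit (wact p.+1 r) <[rot_perm p.+1]>%g w) (mem sym_necklaces)) /=.
  rewrite -sum_nat_const; apply: eq_bigr => N.
  rewrite inE => /andP[/imsetP[w0 Hw0 ->{N}] /eqP].
  move=> /(orbit_sym Hw0)[l]; set w := wshift w0 l => Sw ->.
  have := Sw; rewrite inE => /andP[Hw /eqP Ew].
  rewrite sum1_card -card_order2 -(card_imset _ (wshift_inj Hw)).
  apply: eq_card => v; rewrite unfold_in; apply/andP/imsetP => [[Sv Nv]|[k]].
    have /orbit_rotP[k Ek] : v \in orbit (wact p.+1 r) <[rot_perm p.+1]>%g w.
      by rewrite -(eqP Nv) orbit_refl.
    exists k => //; move: Sv; rewrite !inE Ek wrefl_shift Ew => /andP[_ /eqP].
    by move/(wshift_inj Hw)/eqP; rewrite eq_sym -addr_eq0.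
  rewrite [k \in _]inE => /eqP k2 ->; rewrite inE wshift_words Hw wrefl_shift
    Ew.
  split; first by rewrite -[- k]addr0 -k2 addKr eqxx.
  by apply/eqP/orbit_eqP/orbit_rotP; exists k.
move=> w; rewrite inE => /andP[Hw /eqP Ew]; rewrite inE imset_f //=.
by rewrite refl_necklace_orbit wact_refl Ew.
Qed.

End Necklaces.

(** * Words fixed by the reflection *)

Lemma sum_palindrome p (f : nat -> nat) :
    (forall j, (j < p)%N -> f (p.-1 - j)%N = f j) ->
  (\sum_(j < p) f j = (\sum_(j < p./2) f j).*2 + odd p * f p./2)%N.
Proof.
move=> sym.
(* Cutting at [uphalf p] leaves the middle index, present for odd [p], in the lower part. *)
have E : (\sum_(uphalf p <= j < p) f j = \sum_(j < p./2) f j)%N.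
  rewrite -{1}[uphalf p]add0n big_addn big_nat_rev big_mkord /=.
  have -> : (p - uphalf p = p./2)%N by lia.
  apply: eq_bigr => j _; have lt_j := ltn_ord j.
  by rewrite -sym; [congr f|]; lia.
rewrite -(big_mkord xpredT f) (big_cat_nat (n := uphalf p)) //=; last lia.
rewrite E big_mkord uphalf_half; case: (odd p).
  by rewrite add1n big_ord_recr /= mul1n -addnn addnAC.
by rewrite add0n mul0n addn0 addnn.
Qed.

Lemma val_refl_zmod p (j : 'I_p.+1) :
  (- j - inZp 2 : 'I_p.+1) = (if j == p :> nat then p else p.-1 - j)%N :> nat.
Proof.
by rewrite -refl_permE val_refl_perm eqSS; case: eqP => //; lia.
Qed.

Section Halves.

Variables (p r : nat) (alpha : 'I_r -> nat).
Hypothesis gcd_alpha : \big[gcdn/0%N]_(i < r) alpha i = 1%N.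

Definition first_half (w : word p.+1 r) : word p./2 r :=
  [ffun k : 'I_p./2 => w (inord k)].

(** The last position is fixed by the reflection, and the letters at the first [p] positions form a
    palindrome. *)
Lemma sum_sym (w : word p.+1 r) i :
    wrefl w = w ->
  (\sum_(j < p.+1) (w j == i) =
   (\sum_(k < p./2) (first_half w k == i)).*2
     + odd p * (w (inord p./2) == i) + (w ord_max == i))%N.
Proof.
move/ffunP=> sym; rewrite big_ord_recr /=; congr addn.
rewrite (eq_bigr (fun k : 'I_p => (w (inord k) == i) : nat)) => [|k _];
  last first.
  by congr (nat_of_bool (w _ == i)); apply: val_inj;
    rewrite /= inordK // ltnS ltnW.
rewrite (sum_palindrome (f := fun k => (w (inord k) == i) : nat)).
  by congr (_.*2 + _)%N; apply: eq_bigr => k _; rewrite ffunE.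
move=> j lt_j; rewrite -[w (inord j)]sym ffunE.
congr (nat_of_bool (w _ == i)); apply: ord_inj.
rewrite val_refl_zmod !inordK ?ltnS; [|lia..].
by rewrite ifN // neq_ltn lt_j.
Qed.

(* The pair u.2 holds the letters at the last and at the middle position; for
   even p there is no middle position fixed by tau_0, and axis_letters then
   normalizes u.2.2 to u.2.1. *)
Definition glue (u : word p./2 r * ('I_r * 'I_r)) : word p.+1 r :=
  [ffun j : 'I_p.+1 => if j == p :> nat then u.2.1
    else if insub (minn j (p.-1 - j)) is Some k then u.1 k else u.2.2].

Lemma glue_sym u : wrefl (glue u) = glue u.
Proof.
apply/ffunP=> j; rewrite !ffunE val_refl_zmod; have lt_j := ltn_ord j.
case: (eqVneq (j : nat) p) => [_|ne_j]; first by rewrite eqxx.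
rewrite ifN; last lia.
by congr (if insub _ is Some k then u.1 k else u.2.2); lia.
Qed.

Lemma first_half_glue u : first_half (glue u) = u.1.
Proof.
apply/ffunP=> k; rewrite !ffunE; have lt_k := ltn_ord k.
rewrite inordK ?ifN; [|lia..].
by rewrite (minn_idPl _) ?valK //; lia.
Qed.

Lemma glue_last u : glue u ord_max = u.2.1.
Proof. by rewrite ffunE eqxx. Qed.

Lemma glue_middle u : odd p -> glue u (inord p./2) = u.2.2.
Proof.
move=> odd_p; rewrite ffunE inordK ?ifN; [|lia..].
(* At the middle position the minimum equals [p./2], just outside ['I_p./2]. *)
by rewrite insubF //; lia.
Qed.

Lemma glue_halves w :
    wrefl w = w ->
  w = glue (first_half w,
            (w ord_max, if odd p then w (inord p./2) else w ord_max)).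
Proof.
move/ffunP=> sym; apply/ffunP=> j; rewrite ffunE /=; have lt_j := ltn_ord j.
case: eqP => [jp|/eqP ne_j]; first by congr (w _); apply: val_inj.
case: insubP => [k _ /= Ek|ge_j]; last first.
  by rewrite ifT; [congr (w _); apply: val_inj; rewrite /= inordK|]; lia.
rewrite ffunE Ek; case: (leqP j (p.-1 - j)) => _.
  by congr (w _); apply: val_inj; rewrite /= inordK.
rewrite -[LHS]sym ffunE; congr (w _); apply: ord_inj.
by rewrite val_refl_zmod /= (negPf ne_j) inordK //; lia.
Qed.

(** The two halves supply each letter an even number of times, so the positions on the axis have to
    supply the parity of [alpha i]. *)
Definition axis_letters : {set 'I_r * 'I_r} :=
  [set u | [forall i, (odd p * (u.2 == i) + (u.1 == i) == odd (alpha i))%N]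
           && (odd p || (u.2 == u.1))].

Lemma sym_words_glue :
  sym_words p alpha =
    glue @: setX (words p./2 (fun i => (alpha i)./2)) axis_letters.
Proof.
apply/setP=> w; apply/idP/imsetP => [|[[v [a b]]]]; last first.
  rewrite in_setX /= => /andP[/wordsP Hv]; rewrite inE /=.
  move=> /andP[/forallP Hab _] ->; rewrite inE glue_sym eqxx andbT.
  apply/wordsP=> i; rewrite sum_sym ?glue_sym // first_half_glue glue_last /=
    Hv.
  rewrite -addnA [RHS](esym (odd_double_half _)) addnC -(eqP (Hab i)).
  by case: (boolP (odd p)) => [/glue_middle ->|].
rewrite inE => /andP[/wordsP Hw /eqP Sw].
have {}Hw i := esym (etrans (esym (sum_sym i Sw)) (Hw i)).
exists (first_half w, (w ord_max, if odd p then w (inord p./2) else w ord_max)).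
  (* Equal letters at the two axis positions would make every [alpha i] even. *)
  have ne_ab : odd p -> w (inord p./2) != w ord_max.
    move=> odd_p; apply/eqP=> Eab; suff: 2%N = 1%N by [].
    apply: (common_divisor_eq1 gcd_alpha) => i.
    by rewrite Hw odd_p Eab mul1n -addnA addnn -doubleD dvdn2 odd_double.
  (* With at most one occurrence on the axis, the count in the first half is [(alpha i)./2] and the
     axis count is [odd (alpha i)]. *)
  have Hab i : (odd p * (w (inord p./2) == i) + (w ord_max == i) <= 1)%N.
    case: (boolP (odd p)) => [/ne_ab|_]; last by rewrite mul0n leq_b1.
    rewrite mul1n; case: (eqVneq _ i) => [-> ne|_ _]; last by rewrite leq_b1.
    by rewrite eq_sym (negPf ne).
  rewrite in_setX /=; apply/andP; split.
    apply/wordsP=> i; rewrite Hw -addnA.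
    by move: (Hab i); move: (odd p * _ + _)%N => x; lia.
  rewrite inE /=; apply/andP; split; last by case: (odd p); rewrite ?eqxx.
  apply/forallP=> i; rewrite Hw -addnA; have := Hab i.
  by case: (odd p); move: (_ * _ + _)%N => x; lia.
exact: glue_halves.
Qed.

Lemma glue_inj :
  {in setX (words p./2 (fun i => (alpha i)./2)) axis_letters &,
     injective glue}.
Proof.
case=> v [a b] [v' [a' b']]; rewrite !in_setX /=.
move=> /andP[_]; rewrite inE /= => /andP[_ Eb].
move=> /andP[_]; rewrite inE /= => /andP[_ Eb'] E.
have Ev := congr1 first_half E; rewrite !first_half_glue /= in Ev.
have Ea := congr1 (fun w : word p.+1 r => w ord_max) E;
  rewrite !glue_last /= in Ea.
have Em := congr1 (fun w : word p.+1 r => w (inord p./2)) E.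
rewrite Ev Ea; congr (_, (_, _)); case: (boolP (odd p)) => odd_p.
  by rewrite !glue_middle in Em.
by move: Eb Eb'; rewrite (negPf odd_p) /= => /eqP -> /eqP ->.
Qed.

(** The hypotheses leave exactly as many odd [alpha i] as there are axis positions. Two distinct
    letters can be placed in two orders, a single one in one way. *)
Lemma card_axis_letters :
    (\sum_(i < r) alpha i = p.+1)%N ->
    (\sum_(i < r) (alpha i)./2 = p./2)%N ->
  #|axis_letters| = (odd p).+1.
Proof.
move=> sum_a sum_h; have := sum_half alpha; rewrite sum_a sum_h.
set O := [set i | odd (alpha i)].
have inO i : odd (alpha i) = (i \in O) by rewrite inE.
case: (boolP (odd p)) => odd_p cardO.
  have /cards2P[x [y [ne_xy EO]]] : #|O| == 2%N by lia.
  rewrite (_ : axis_letters = [set (x, y); (y, x)]).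
    by rewrite cards2 xpair_eqE (negPf ne_xy).
  apply/setP=> [[a b]]; rewrite !inE !xpair_eqE /= odd_p andbT.
  apply/forallP/idP => [H|H i]; last first.
    rewrite mul1n inO EO !inE ![i == _]eq_sym.
    have: ~~ ((x == i) && (y == i)).
      by apply: contra ne_xy => /andP[/eqP -> /eqP ->].
    by case/orP: H => /andP[/eqP -> /eqP ->]; case: (x == i); case: (y == i).
  have := H a; have := H b; rewrite !mul1n !inO EO !inE !eqxx.
  case: (eqVneq a b) => [->|ne_ab]; first by case: (_ || _).
  rewrite addn0 add0n.
  case: (eqVneq b x) ne_ab => [->|_] ne_ab /=.
    by rewrite (negPf ne_ab) (negPf ne_xy) /=; case: (a == y).
  case: (eqVneq b y) ne_ab => [->|_] //= ne_ab _.
  by rewrite (negPf ne_ab); case: (a == x).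
have /cards1P[x EO] : #|O| == 1%N by lia.
rewrite (_ : axis_letters = [set (x, x)]) ?cards1 //.
apply/setP=> [[a b]]; rewrite !inE xpair_eqE /= (negPf odd_p) /=.
apply/andP/andP => [[/forallP H /eqP ->]|[/eqP -> /eqP ->]].
  by have := H x; rewrite mul0n inO EO inE eqxx; case: (a == x).
split=> //; apply/forallP=> i.
by rewrite mul0n inO EO inE [i == x]eq_sym.
Qed.

(** The factor [(odd p).+1] counts both the fixed words in a fixed necklace and the choices of axis
    letters, so it cancels. *)
Lemma card_sym_necklaces :
    (\sum_(i < r) alpha i = p.+1)%N ->
  #|sym_necklaces p alpha| = #|words p./2 (fun i => (alpha i)./2)|.
Proof.
move=> sum_a; apply/eqP; rewrite -(eqn_pmul2r (ltn0Sn (odd p))).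
rewrite -card_sym_words // sym_words_glue (card_in_imset glue_inj) cardsX.
(* A word of the halved content certifies that the halves sum to [p./2], as [card_axis_letters]
   requires; without one both sides are 0. *)
case: (set_0Vmem (words p./2 (fun i => (alpha i)./2))) => [->|[v /sum_words]].
  by rewrite cards0.
by move/(card_axis_letters sum_a)=> ->.
Qed.

End Halves.

(** * Bracelets as orbits of an involution *)

Lemma refl_permK n : (refl_perm n * refl_perm n)%g = 1%g.
Proof.
case: n => [|p]; first by apply/permP=> -[].
apply/permP=> j; rewrite permM !refl_permE perm1.
by rewrite opprD !opprK addrK.
Qed.

Lemma refl_necklaceK n r : involutive (@refl_necklace n r).
Proof.
move=> N; rewrite /refl_necklace -actM refl_permK; exact: act1.
Qed.

Lemma refl_necklace_in n r alpha (N : {set word n r}) :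
  N \in necklaces n alpha -> refl_necklace N \in necklaces n alpha.
Proof.
case/imsetP=> w Hw ->; rewrite refl_necklace_orbit imset_f //.
by rewrite words_act.
Qed.

Lemma orbit_reflE n r (N : {set word n r}) :
  orbit ((wact n r)^*)%act <[refl_perm n]>%g N = [set N; refl_necklace N].
Proof.
apply/setP=> M; rewrite !inE; apply/orbitP/orP => [[_ /cycleP[m ->] <-]|].
  rewrite -[m]odd_double_half expgD -mul2n expgM expgS expg1 refl_permK expg1n
    mulg1.
  by case: (odd m); [right|left]; rewrite ?expg1 ?expg0 ?act1.
case=> /eqP ->; first by exists 1%g; rewrite ?group1 ?act1.
by exists (refl_perm n); rewrite ?cycle_id.
Qed.

(* Every bracelet has one or two elements, and those with one element are
   the fixed necklaces. *)
Lemma card_bracelets n r (alpha : 'I_r -> nat) :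
  let s := #|[set N in necklaces n alpha | refl_necklace N == N]| in
  let a := #|asymmetric_bracelets n alpha| in
  #|bracelets n alpha| = (s + a)%N /\ #|necklaces n alpha| = (s + a.*2)%N.
Proof.
move=> s a; pose S := [set B in bracelets n alpha | #|B| != 2].
have cardS : #|S| = s.
  rewrite /s -(card_imset _ (@set1_inj {set word n r})); apply: eq_card => B.
  apply/idP/imsetP => [|[N]].
    rewrite inE => /andP[/imsetP[N HN ->]]; rewrite orbit_reflE cards2.
    case: (N =P refl_necklace N) => //= E _; exists N;
      first by rewrite inE HN -E eqxx.
    by rewrite -E setUid.
  rewrite inE => /andP[HN /eqP E] ->; rewrite inE cards1 andbT.
  by apply/imsetP; exists N => //; rewrite orbit_reflE E setUid.
have cardB : #|bracelets n alpha| = (s + a)%N.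
  rewrite -cardS -(cardsID S); congr addn; apply: eq_card => B; rewrite !inE.
    by case: (B \in _).
  by rewrite negb_and negbK andbC; case: (B \in _).
have acts : [acts <[refl_perm n]>%g, on necklaces n alpha | (wact n r)^*%act].
  rewrite gen_subG sub1set !inE /=; apply/subsetP=> N HN.
  by rewrite inE refl_necklace_in.
split=> //; rewrite -(acts_sum_card_orbit acts) -/(bracelets n alpha).
rewrite (bigID (fun B : {set {set word n r}} => #|B| != 2)) /=; congr addn.
  rewrite -cardS -sum1_card; apply: eq_big => B; first by rewrite !inE.
  case/andP=> /imsetP[N HN ->]; rewrite orbit_reflE cards2.
  by case: (N == _).
rewrite -muln2 -sum_nat_const; apply: eq_big => B; first by rewrite !inE negbK.
by case/andP=> _; rewrite negbK => /eqP.
Qed.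

(** * Even and odd coefficients, and the final count *)

Lemma horner1_even_odd (C : {poly int}) :
  C.[1] = \sum_(i < size C | ~~ odd i) C`_i + \sum_(i < size C | odd i) C`_i.
Proof.
rewrite horner_coef (eq_bigr (fun i : 'I_(size C) => C`_i)) => [|i _].
  by rewrite (bigID (fun i : 'I_(size C) => odd i)) addrC.
by rewrite expr1n mulr1.
Qed.

Lemma hornerN1_even_odd (C : {poly int}) :
  C.[-1] = \sum_(i < size C | ~~ odd i) C`_i - \sum_(i < size C | odd i) C`_i.
Proof.
rewrite horner_coef (bigID (fun i : 'I_(size C) => odd i)) [RHS]addrC /= -sumrN.
congr (_ + _); apply: eq_bigr => i; rewrite -signr_odd.
  by move=> ->; rewrite mulrN1.
by move/negPf=> ->; rewrite mulr1.
Qed.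

Lemma qC_stembridge p r (alpha : 'I_r -> nat) :
    (\sum_(i < r) alpha i = p.+1)%N ->
    \big[gcdn/0%N]_(i < r) alpha i = 1%N ->
  stembridge_phenomenon (necklaces p.+1 alpha) (qC p.+1 alpha)
    (@refl_necklace p.+1 r).
Proof.
move=> sum_a gcd_a; split.
- exact: refl_necklace_in.
- by move=> N _; apply: refl_necklaceK.
- have prod_n0 : (\prod_(i < r) (alpha i)`!)%N%:R != 0 :> int.
    by rewrite Num.Theory.pnatr_eq0 -lt0n prodn_gt0 // => i; apply: fact_gt0.
  apply: (mulIf prod_n0); rewrite qC_horner1 //.
  rewrite -[X in _ = X * _]natz -natrM; congr (_%:R).
  (* Multiplying by n turns [p] factorial into n factorial, and the number of necklaces into the
     number of words. *)
  apply/eqP; rewrite -(eqn_pmul2l (ltn0Sn p)) -factS -(card_words sum_a).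
  by rewrite card_necklaces // mulnA [(p.+1 * _)%N]mulnC.
have prod_n0 : (\prod_(i < r) (alpha i)./2`!)%N%:R != 0 :> int.
  by rewrite Num.Theory.pnatr_eq0 -lt0n prodn_gt0 // => i; apply: fact_gt0.
apply: (mulIf prod_n0); rewrite qC_hornerN1 //.
rewrite -[X in _ = X * _]natz -natrM; congr (_%:R).
rewrite -/(sym_necklaces p alpha) card_sym_necklaces //.
(* If the halves do not sum to [p./2], the value at -1 is 0 and no word has the halved content. *)
case: eqP => [/card_words <-|ne]; first by rewrite mul1n.
case: (set_0Vmem (words p./2 (fun i => (alpha i)./2))) => [->|[v /sum_words
  //]].
by rewrite cards0.
Qed.

Theorem theorem1p3 (r n : nat) (alpha : 'I_r -> nat)
    (sum_alpha : (\sum_(i < r) alpha i = n)%N)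
    (gcd_alpha : \big[gcdn/0%N]_(i < r) alpha i = 1%N) :
  let C := qC n alpha in
  [/\ stembridge_phenomenon (necklaces n alpha) C (@refl_necklace n r),
      1 / 2 * (C.[1]%:~R + C.[-1]%:~R)
        = (\sum_(i < size C | ~~ odd i) C`_i)%:~R :> rat,
      \sum_(i < size C | ~~ odd i) C`_i = #|bracelets n alpha|%:Z,
      1 / 2 * (C.[1]%:~R - C.[-1]%:~R)
        = (\sum_(i < size C | odd i) C`_i)%:~R :> rat
    & \sum_(i < size C | odd i) C`_i = #|asymmetric_bracelets n alpha|%:Z].
Proof.
case: n => [|p] in sum_alpha *.
  (* For n = 0 all [alpha i] vanish, so 2 would be a common divisor. *)
  suff: 2%N = 1%N by [].
  apply: (common_divisor_eq1 gcd_alpha) => i; move: sum_alpha.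
  by rewrite (bigD1 i) //= => /eqP; rewrite addn_eq0 => /andP[/eqP ->].
move=> C; have St := qC_stembridge sum_alpha gcd_alpha.
have [_ _] := St; rewrite -/C horner1_even_odd hornerN1_even_odd.
(* With s fixed necklaces and a asymmetric bracelets, the even sum E and odd sum O of coefficients
   satisfy E + O = s + 2a and E - O = s, so E = s + a and O = a. *)
have [-> ->] := card_bracelets p.+1 alpha.
set s := #|[set _ in _ | _]|; set a := #|asymmetric_bracelets _ _|.
set E := \sum_(_ < _ | ~~ _) _; set O := \sum_(_ < _ | _) _ => E1 EN1.
split=> //.
- by rewrite !intrD !intrN; field.
- lia.
- by rewrite !intrD !intrN; field.
- lia.
Qed.
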